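(* Let $M\in[0,1]^{m\times n}$, $\rho\in[0,1)$, $t>0$, and $\delta\in(0,1)$. Let $Y\in\{0,1\}^{m\times n}$ have independent entries with $P(Y_{ij}=1)=M_{ij}$, let $s$ denote the number of ones in $Y$, and let $A\in\{0,1\}^{m\times n}$ be the observation matrix with independent entries satisfying $P(A_{ij}=1)=M_{ij}(1-\rho)$, $P(A_{ij}=0)=1-M_{ij}(1-\rho)$, obtained by revealing each 1 of $Y$ independently with probability $1-\rho$ (0's of $Y$ always give $A_{ij}=0$). Define $$\tilde{\ell}(x,a)=\begin{cases}\dfrac{(x-1)^2-\rho x^2}{1-\rho} & \text{if } a=1,\\[1mm] x^2 & \text{if } a=0,\end{cases}$$ the empirical error $\hat{R}_{\tilde{\ell}}(X)=\frac{1}{mn}\sum_{i,j}\tilde{\ell}(X_{ij},A_{ij})$ and the expected error $E_A[R_{\tilde{\ell}}(X)]=E_A\big[\frac{1}{mn}\sum_{i,j}\tilde{\ell}(X_{ij},A_{ij})\big]$. Let $\mathcal{X}=\{X\in\mathbb{R}^{m\times n}:\|X\|_*\le t,\ 0\le X_{ij}\le 1\ \forall (i,j)\}$. Then there is a constant $C$ such that, with probability at least $1-\delta$, $$\max_{X\in\mathcal{X}}\Big|E_A[R_{\tilde{\ell}}(X)]-\hat{R}_{\tilde{\ell}}(X)\Big|\le tC\,\frac{\sqrt{n}+\sqrt{m}+\sqrt[4]{s}}{(1-\rho)mn}+3\,\frac{\sqrt{\log(2/\delta)}}{\sqrt{mn}\,(1-\rho)}.$$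
   Context: $\|X\|_*$ denotes the nuclear (trace) norm. This is the non-deterministic PU matrix completion model: each entry $M_{ij}$ is the probability that the clean binary entry $Y_{ij}$ equals 1, and only a random fraction $1-\rho$ of the ones of $Y$ are observed (recorded as $A_{ij}=1$); all other entries of $A$ are $0$. *)

(* Defs.v *)
From HB Require Import structures.
From mathcomp Require Import all_boot all_order all_algebra.
From mathcomp Require Import boolp classical_sets reals exp.
Set Implicit Arguments. Unset Strict Implicit. Unset Printing Implicit Defensive.
Import Order.TTheory GRing.Theory Num.Theory.
Local Open Scope ring_scope.

Section PUDefs.
Variable R : realType.

Definition singular_values (m n : nat) (X : 'M[R]_(m, n)) (sv : 'rV[R]_n) : Prop :=
  (forall i, 0 <= sv 0 i) /\
  char_poly (X^T *m X) = \prod_(i < n) ('X - (sv 0 i ^+ 2)%:P).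

Definition nuclear_norm (m n : nat) (X : 'M[R]_(m, n)) : R :=
  \sum_(i < n) (xget 0 [set sv | singular_values X sv]) 0 i.

(* Sample space: for each entry (i,j), a pair (Y_ij, reveal_ij). *)
Definition Omega (m n : nat) := {ffun 'I_m * 'I_n -> bool * bool}.

Definition prob (m n : nat) (M : 'M[R]_(m, n)) (rho : R) (w : Omega m n) : R :=
  \prod_(k : 'I_m * 'I_n)
     ((if (w k).1 then M k.1 k.2 else 1 - M k.1 k.2) *
      (if (w k).2 then 1 - rho else rho)).

Definition Pr (m n : nat) (M : 'M[R]_(m, n)) (rho : R) (E : Omega m n -> Prop) : R :=
  \sum_(w : Omega m n | `[< E w >]) prob M rho w.

Definition Ymat (m n : nat) (w : Omega m n) (i : 'I_m) (j : 'I_n) : bool := (w (i, j)).1.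
Definition Amat (m n : nat) (w : Omega m n) (i : 'I_m) (j : 'I_n) : bool :=
  (w (i, j)).1 && (w (i, j)).2.

Definition s_ones (m n : nat) (w : Omega m n) : nat := #|[set k | (w k).1]|.

Definition ltilde (rho x : R) (a : bool) : R :=
  if a then ((x - 1) ^+ 2 - rho * x ^+ 2) / (1 - rho) else x ^+ 2.

Definition Rhat (m n : nat) (rho : R) (X : 'M[R]_(m, n)) (w : Omega m n) : R :=
  (m * n)%:R^-1 * \sum_(i < m) \sum_(j < n) ltilde rho (X i j) (Amat w i j).

Definition ER (m n : nat) (M : 'M[R]_(m, n)) (rho : R) (X : 'M[R]_(m, n)) : R :=
  \sum_(w : Omega m n) prob M rho w * Rhat rho X w.

Definition Xset (m n : nat) (t : R) (X : 'M[R]_(m, n)) : Prop :=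
  nuclear_norm X <= t /\ (forall i j, 0 <= X i j <= 1).

End PUDefs.

(* Main.v *)
(** Since [ltilde x 1 - ltilde x 0 = (1 - 2 x) / (1 - rho)], the deviation of the
    empirical error is [<B, 1 - 2 X> / ((1 - rho) m n)], where [B] is the centred
    observation matrix [A - E A].  The supremum of [<B, 1 - 2 X>] over the class (and
    likewise of its opposite) changes by at most 1 when one entry is resampled, so by
    McDiarmid it exceeds its mean by more than [3 sqrt (m n log (2 / delta))] with
    probability at most [delta / 2].  The sum of the entries of [B] has mean zero, so
    by trace duality that mean is at most [2 t E |B|_op].  Finally
    [E |B|_op <= 39 sqrt (m + n)], because the operator norm is dominated by a maximum
    of sub-Gaussian linear forms over the pairs of integer vectors of squared norms at
    most [4 m] and [4 n], of which there are at most [64 ^ (m + n)]. *)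

Require Import Defs.
From HB Require Import structures.
From mathcomp Require Import all_boot all_order all_algebra.
From mathcomp Require Import boolp classical_sets reals exp.
From mathcomp Require Import sequences.
From mathcomp Require Import spectral sesquilinear complex.
From mathcomp Require Import ring lra.
Set Implicit Arguments. Unset Strict Implicit. Unset Printing Implicit Defensive.
Import Order.TTheory GRing.Theory Num.Theory.
Local Open Scope ring_scope.

(** For a centred variable the linear term averages out and a sub-Gaussian bound remains. For small
    [|x|] it follows from [expR x <= 1 / (1 - x)] and a polynomial comparison; beyond [1/2] one has
    [x <= 2 x^2]. *)
Lemma expR_le_id_expR (R : realType) (x : R) : expR x <= x + expR (2 * x ^+ 2).
Proof.
have sq2 := expR_ge1Dx (2 * x ^+ 2).
have [x0|x0] := lerP x 0.
  have [x1|x1] := lerP x (-1).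
    have : expR x <= 1 by rewrite expR_le1.
    by nra.
  suff : expR x <= 1 + x + x ^+ 2 by nra.
  have e1 := expR_ge1Dx (- x); have e0 := expR_gt0 x.
  have : expR x * expR (- x) = 1 by rewrite expRxMexpNx_1.
  by nra.
have [x1|x1] := lerP x (1/2); last first.
  suff : expR x <= expR (2 * x ^+ 2) by lra.
  by rewrite ler_expR; nra.
suff : expR x <= 1 + x + 2 * x ^+ 2 by lra.
have e1 := expR_ge1Dx (- x); have e0 := expR_gt0 x.
have h : expR x * expR (- x) = 1 by rewrite expRxMexpNx_1.
have h2 : expR x * (1 - x) <= 1 by nra.
have h3 : 1 <= (1 - x) * (1 + x + 2 * x ^+ 2).
  have : 0 <= x ^+ 2 * (1 - 2 * x) by apply: mulr_ge0; [exact: sqr_ge0|lra].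
  by nra.
have h4 : 0 < 1 - x by lra.
by rewrite -(ler_pM2r h4); nra.
Qed.

(** * Bounded differences on finite product spaces *)

Section ProductSpace.
Variables (R : realType) (I T : finType) (P : I -> T -> R).
Hypothesis P_ge0 : forall k b, 0 <= P k b.
Hypothesis P_sum1 : forall k, \sum_b P k b = 1.
Implicit Types (f g : {ffun I -> T} -> R) (w : {ffun I -> T}) (c : I -> R).

Definition weight w := \prod_k P k (w k).
Definition expect f := \sum_w weight w * f w.
Definition upd w k b : {ffun I -> T} := [ffun j => if j == k then b else w j].
(** The conditional expectation of [f] given all coordinates but [k], still a function on the whole
    space. *)
Definition average k f w := \sum_b P k b * f (upd w k b).
Definition bounded_diff c f := forall k w b, `|f (upd w k b) - f w| <= c k.

Lemma weight_ge0 w : 0 <= weight w.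
Proof. by apply: prodr_ge0. Qed.

Lemma weight_sum1 : \sum_w weight w = 1.
Proof. by rewrite -bigA_distr_bigA /= big1. Qed.

Lemma expect_cst a : expect (fun=> a) = a.
Proof. by rewrite /expect -mulr_suml weight_sum1 mul1r. Qed.

Lemma expectD f g : expect (fun w => f w + g w) = expect f + expect g.
Proof. by rewrite -big_split; apply: eq_bigr => w _; rewrite mulrDr. Qed.

Lemma expectZ a f : expect (fun w => a * f w) = a * expect f.
Proof. by rewrite /expect mulr_sumr; apply: eq_bigr => w _; rewrite mulrCA. Qed.

Lemma expect_sum (J : finType) (F : J -> {ffun I -> T} -> R) :
  expect (fun w => \sum_j F j w) = \sum_j expect (F j).
Proof.
by rewrite /expect exchange_big; apply: eq_bigr => w _; rewrite mulr_sumr.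
Qed.

Lemma le_expect f g : (forall w, f w <= g w) -> expect f <= expect g.
Proof. by move=> fg; apply: ler_sum => w _; rewrite ler_wpM2l ?weight_ge0. Qed.

Lemma eq_expect f g : f =1 g -> expect f = expect g.
Proof. by move=> fg; apply: eq_bigr => w _; rewrite fg. Qed.

Lemma upd_id w k : upd w k (w k) = w.
Proof. by apply/ffunP => j; rewrite ffunE; case: eqP => [->|]. Qed.

Lemma upd_upd w k b b' : upd (upd w k b) k b' = upd w k b'.
Proof. by apply/ffunP => j; rewrite !ffunE; case: eqP. Qed.

Lemma updC w k j b b' : j != k -> upd (upd w k b) j b' = upd (upd w j b') k b.
Proof.
move=> jk; apply/ffunP => i; rewrite !ffunE.
by case: (eqVneq i j) => [->|//]; rewrite (negPf jk).
Qed.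

(** Exchanging the coordinate [k] with an independent fresh copy is an involution that preserves the
    joint law. *)
Lemma expect_average k f : expect (average k f) = expect f.
Proof.
pose swap (p : {ffun I -> T} * T) := (upd p.1 k p.2, p.1 k).
have swapK : involutive swap.
  by case=> w b; rewrite /swap /= upd_upd upd_id ffunE eqxx.
transitivity (\sum_(p : {ffun I -> T} * T) weight p.1 * P k p.2 * f (upd p.1 k p.2)).
  rewrite /expect -(pair_bigA _ (fun w b => weight w * P k b * f (upd w k b))) /=.
  by apply: eq_bigr => w _; rewrite mulr_sumr; apply: eq_bigr => b _; rewrite mulrA.
rewrite (reindex_inj (inv_inj swapK)) /=.
transitivity (\sum_(p : {ffun I -> T} * T) weight p.1 * P k p.2 * f p.1).
  apply: eq_bigr => -[w b] _ /=; rewrite upd_upd upd_id; congr (_ * _).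
  rewrite /weight (bigD1 k) //= [X in _ = X * _](bigD1 k) //= ffunE eqxx.
  rewrite (eq_bigr (fun i => P i (w i))); first by ring.
  by move=> i ik; rewrite ffunE (negPf ik).
rewrite -(pair_bigA _ (fun w b => weight w * P k b * f w)) /=.
apply: eq_bigr => w _; rewrite -mulr_suml -mulr_sumr P_sum1 mulr1 //.
Qed.

Lemma expect_coord k (h : T -> R) : expect (fun w => h (w k)) = \sum_b P k b * h b.
Proof.
rewrite -(expect_average k) -[RHS]expect_cst; apply: eq_expect => w.
by apply: eq_bigr => b _; rewrite ffunE eqxx.
Qed.

(* The optimal constant is 1/8; 2 suffices for the coefficient 3 of the theorem. *)
Lemma hoeffding_lemma k (Z : T -> R) (c : R) : (forall b b', `|Z b - Z b'| <= c) ->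
  \sum_b P k b * expR (Z b) <= expR (2 * c ^+ 2) * expR (\sum_b P k b * Z b).
Proof.
move=> Zc; set mu := \sum_b P k b * Z b.
have dev b : `|Z b - mu| <= c.
  have -> : Z b - mu = \sum_b' P k b' * (Z b - Z b').
    under [RHS]eq_bigr do rewrite mulrBr.
    by rewrite sumrB -mulr_suml P_sum1 mul1r.
  apply: le_trans (ler_norm_sum _ _ _) _.
  rewrite -[c]mul1r -(P_sum1 k) mulr_suml; apply: ler_sum => b' _.
  by rewrite normrM ger0_norm // ler_wpM2l.
(* [expR_le_id_expR] is applied to [Z b - mu], whose mean vanishes once summed against [P k]. *)
have step b : expR (Z b) <= (Z b - mu + expR (2 * c ^+ 2)) * expR mu.
  rewrite -{1}(subrK mu (Z b)) expRD ler_pM2r ?expR_gt0 //.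
  apply: le_trans (expR_le_id_expR _) _; rewrite lerD2l ler_expR ler_pM2l //.
  by rewrite -real_normK ?num_real // lerXn2r ?nnegrE // (le_trans _ (dev b)).
apply: le_trans (ler_sum _ (fun b _ => ler_wpM2l (P_ge0 k b) (step b))) _.
under eq_bigr do rewrite mulrA.
rewrite -mulr_suml ler_pM2r ?expR_gt0 //.
under eq_bigr do rewrite mulrDr mulrBr.
by rewrite big_split sumrB /= -!mulr_suml P_sum1 !mul1r subrr add0r.
Qed.

Lemma bounded_diff_average c k f : bounded_diff c f -> bounded_diff c (average k f).
Proof.
move=> fc j w b.
have -> : average k f (upd w j b) - average k f w
        = \sum_b' P k b' * (f (upd (upd w j b) k b') - f (upd w k b')).
  by rewrite -sumrB; apply: eq_bigr => b' _; rewrite mulrBr.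
apply: le_trans (ler_norm_sum _ _ _) _.
rewrite -[c j]mul1r -(P_sum1 k) mulr_suml; apply: ler_sum => b' _.
rewrite normrM ger0_norm // ler_wpM2l //.
have [->|jk] := eqVneq j k; last by rewrite updC ?fc // eq_sym.
(* An average over [k] ignores the coordinate [k]; [0 <= c k] because [c k] bounds an absolute
   value. *)
by rewrite upd_upd subrr normr0 (le_trans _ (fc k w b)).
Qed.

Lemma expect_expR_average c k f : bounded_diff c f ->
  expect (fun w => expR (f w)) <= expR (2 * c k ^+ 2) * expect (fun w => expR (average k f w)).
Proof.
move=> fc; rewrite -(expect_average k) -expectZ; apply: le_expect => w.
by apply: hoeffding_lemma => b b'; have := fc k (upd w k b') b; rewrite upd_upd.
Qed.

Definition averages (s : seq I) f := foldl (fun g k => average k g) f s.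

Lemma expect_averages s f : expect (averages s f) = expect f.
Proof. by elim: s f => //= k s IHs f; rewrite IHs expect_average. Qed.

Lemma expect_expR_averages c s f : bounded_diff c f ->
  expect (fun w => expR (f w))
    <= expR (2 * \sum_(k <- s) c k ^+ 2) * expect (fun w => expR (averages s f w)).
Proof.
elim: s f => [|k s IHs] f fc; first by rewrite big_nil mulr0 expR0 mul1r.
apply: le_trans (expect_expR_average k fc) _.
rewrite big_cons mulrDr expRD -mulrA ler_pM2l ?expR_gt0 //.
exact: IHs (bounded_diff_average k fc).
Qed.

(** [D] holds the coordinates that [f] ignores. Each averaging adds one to it, and this generality
    carries the induction on [s]. *)
Lemma averages_eq s (D : {pred I}) f w w' :
  (forall u u' : {ffun I -> T}, (forall j, j \notin D -> u j = u' j) -> f u = f u') ->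
  (forall j, j \notin D -> j \notin s -> w j = w' j) -> averages s f w = averages s f w'.
Proof.
elim: s D f => [|k s IHs] D f fD ww' /=; first by apply: fD => j jD; apply: ww'.
apply: (IHs [predU1 k & D]) => [u u' uu'|j].
  apply: eq_bigr => b _; congr (_ * _); apply: fD => j jD; rewrite !ffunE.
  by case: eqVneq => // jk; apply: uu'; rewrite !inE negb_or jk.
by rewrite !inE negb_or => /andP[jk jD] js; apply: ww' => //; rewrite inE negb_or jk.
Qed.

Lemma averages_enum f w : averages (enum I) f w = expect f.
Proof.
rewrite -(expect_averages (enum I)) -[LHS]expect_cst; apply: eq_expect => w'.
apply: (@averages_eq _ pred0) => [u u' uu'|j _]; last by rewrite mem_enum.
by congr f; apply/ffunP => j; apply: uu'.
Qed.

(** The coordinates are integrated out one by one, each at the cost of a factor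
    [expR (2 * c k ^+ 2)] from Hoeffding's lemma, until only the constant [expect f] is left. *)
Lemma mcdiarmid c f : bounded_diff c f ->
  expect (fun w => expR (f w)) <= expR (2 * \sum_k c k ^+ 2 + expect f).
Proof.
move=> fc; apply: le_trans (expect_expR_averages (enum I) fc) _.
by rewrite (eq_expect (fun w => congr1 expR (averages_enum f w))) expect_cst expRD big_enum.
Qed.

End ProductSpace.

(** * Expected maximum of finitely many variables *)

Lemma expect_bigmax (R : realType) (I T J : finType) (P : I -> T -> R)
    (A : {pred J}) (F : J -> {ffun I -> T} -> R) (lam c l : R) :
  (forall k b, 0 <= P k b) -> (forall k, \sum_b P k b = 1) ->
  (forall j, j \in A -> expect P (fun w => expR (lam * F j w)) <= c) ->
  1 + #|A|%:R * c <= expR l ->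
  lam * expect P (fun w => \big[Num.max/0]_(j in A) F j w) <= l.
Proof.
move=> P0 P1 Fc Al; set Q := fun w => _.
(* The leading 1 accounts for the default value 0 of the maximum. *)
have Qsum w : expR (lam * Q w) <= 1 + \sum_(j in A) expR (lam * F j w).
  rewrite {}/Q; elim/big_rec2: _ => [|j x y jA].
    by rewrite mulr0 expR0 addr0.
  have eF := expR_ge0 (lam * F j w); have ey := expR_ge0 (lam * y).
  by rewrite /Num.max; case: ifP => _ yx; lra.
rewrite -expectZ.
(* The tangent of the exponential at [l] bounds [lam * Q w] and takes the place of Jensen's
   inequality. *)
have /(le_expect P0) : forall w,
    lam * Q w <= l - 1 + expR (- l) * (1 + \sum_(j in A) expR (lam * F j w)).
  move=> w; have := expR_ge1Dx (lam * Q w - l); rewrite expRD.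
  have := Qsum w; have := expR_gt0 (- l).
  set a := expR (- l); set b := expR (lam * Q w); set d := \sum_(_ in _) _.
  by nra.
move/le_trans; apply.
rewrite expectD (expect_cst P1) expectZ expectD (expect_cst P1).
have -> : expect P (fun w => \sum_(j in A) expR (lam * F j w))
  = \sum_(j in A) expect P (fun w => expR (lam * F j w)).
  by rewrite /expect exchange_big; apply: eq_bigr => w _; rewrite mulr_sumr.
have : \sum_(j in A) expect P (fun w => expR (lam * F j w)) <= #|A|%:R * c.
  by rewrite mulr_natl -sumr_const; apply: ler_sum.
have := expR_gt0 (- l); have := expRxMexpNx_1 l; nra.
Qed.

(** * Operator norm of a matrix with independent centred entries *)

Lemma leq_square k : (k <= k ^ 2)%N.
Proof. by case: k => // k; rewrite -mulnn leq_pmull. Qed.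

(** * Rounding vectors to integer points *)

Section Rounding.
Variable R : realType.

(** Integers are coded by sign and magnitude so that vectors of them form a finite type; the count
    in [card_grid] includes both codes of zero. *)
Definition signed_nat K (p : bool * 'I_K) : R := (-1) ^+ p.1 * p.2%:R.

(** Magnitudes up to [4 * m] suffice, since [k <= k ^ 2] for every coordinate of a vector of squared
    norm at most [4 m]. *)
Definition grid m : {pred {ffun 'I_m -> bool * 'I_(4 * m).+1}} :=
  [pred z : {ffun 'I_m -> bool * 'I_(4 * m).+1} | \sum_i signed_nat (z i) ^+ 2 <= (4 * m)%:R].
Arguments grid : clear implicits.

Definition bilin m n (B : 'M[R]_(m, n)) (v : 'I_m -> R) (u : 'I_n -> R) : R :=
  \sum_i \sum_j v i * B i j * u j.

(** A finite maximum that dominates [sqrt (m n)] times the operator norm of [B]. *)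
Definition grid_max m n (B : 'M[R]_(m, n)) : R :=
  \big[Num.max/0]_(p | (p.1 \in grid m) && (p.2 \in grid n))
    bilin B (fun i => signed_nat (p.1 i)) (fun j => signed_nat (p.2 j)).

Lemma signed_nat_sqr K (p : bool * 'I_K) : signed_nat p ^+ 2 = (p.2 ^ 2)%:R.
Proof. by rewrite exprMn sqrr_sign mul1r natrX. Qed.

(* Rounding up or down in the direction in which the linear function grows never decreases it. *)
Lemma rounding1 (a v : R) : exists p : bool * nat,
  a * v <= a * ((-1) ^+ p.1 * p.2%:R) /\ (p.2 ^ 2)%:R <= 2 * v ^+ 2 + 2.
Proof.
have := truncn_itv (normr_ge0 v); set k := Num.truncn _ => /andP[k1 k2].
have k0 : 0 <= k%:R :> R by [].
have n2 : `|v| ^+ 2 = v ^+ 2 by rewrite real_normK // num_real.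
have s : (-1) ^+ (v < 0)%R * `|v| = v.
  have [h|h] := ltP v 0; last by rewrite mul1r ger0_norm.
  by rewrite expr1 mulN1r ltr0_norm // opprK.
set e := (-1) ^+ (v < 0)%R in s.
rewrite -natr1 in k2.
(* [y1] yields [(|v| + 1)^2 <= 2 v^2 + 2], and [yk] amounts to [(k + 1)^2 <= (|v| + 1)^2]. *)
have y1 := sqr_ge0 (`|v| - 1).
have yk : 0 <= (`|v| - k%:R) * (`|v| + k%:R + 2) by rewrite mulr_ge0 // ?subr_ge0 // !addr_ge0.
have [a0|a0] := lerP 0 (a * e); [exists ((v < 0)%R, k.+1)|exists ((v < 0)%R, k)].
  split => /=; last by rewrite natrX -natr1 -n2; nra.
  by rewrite -{1}s !mulrA ler_wpM2l // -natr1 ltW.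
split => /=; last by rewrite natrX -n2; nra.
by rewrite -{1}s !mulrA ler_wnM2l // ltW.
Qed.

(** Coordinatewise use of [rounding1]: the squares sum to at most [2 m + 2 m], whence the radius
    [4 m] in [grid]. *)
Lemma rounding m (a v : 'I_m -> R) : \sum_i v i ^+ 2 <= m%:R ->
  exists2 z, z \in grid m & \sum_i a i * v i <= \sum_i a i * signed_nat (z i).
Proof.
move=> vm; have [p pP] := fin_all_exists (fun i => rounding1 (a i) (v i)).
have p2 : (\sum_i (p i).2 ^ 2 <= 4 * m)%N.
  rewrite -(ler_nat R) natr_sum.
  apply: (@le_trans _ _ (\sum_i (2 * v i ^+ 2 + 2))).
    by apply: ler_sum => i _; case: (pP i).
  rewrite big_split /= -mulr_sumr sumr_const card_ord natrM -mulr_natr; nra.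
have pK i : ((p i).2 < (4 * m).+1)%N.
  rewrite ltnS (leq_trans _ p2) // (bigD1 i) //= (leq_trans _ (leq_addr _ _)) //.
  exact: leq_square.
exists [ffun i => ((p i).1, Ordinal (pK i))].
  rewrite -(ler_nat R) natr_sum in p2; rewrite inE; apply: le_trans p2.
  by apply: ler_sum => i _; rewrite ffunE signed_nat_sqr.
by apply: ler_sum => i _; rewrite ffunE; case: (pP i).
Qed.

Lemma bilinE1 m n (B : 'M[R]_(m, n)) v u : bilin B v u = \sum_i (\sum_j B i j * u j) * v i.
Proof.
apply: eq_bigr => i _; rewrite mulr_suml; apply: eq_bigr => j _.
by rewrite [RHS]mulrC mulrA.
Qed.

Lemma bilinE2 m n (B : 'M[R]_(m, n)) v u : bilin B v u = \sum_j (\sum_i v i * B i j) * u j.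
Proof. by rewrite /bilin exchange_big; apply: eq_bigr => j _; rewrite mulr_suml. Qed.

(** The form is linear in each argument, so rounding [v] with [u] fixed, then [u] with the rounded
    [v] fixed, never decreases it; there is no discretisation error to absorb. *)
Lemma bilin_le_grid_max m n (B : 'M[R]_(m, n)) v u :
  \sum_i v i ^+ 2 <= m%:R -> \sum_j u j ^+ 2 <= n%:R -> bilin B v u <= grid_max B.
Proof.
move=> vm un; rewrite bilinE1.
have [z zg] := rounding (fun i => \sum_j B i j * u j) vm.
move/le_trans; apply; rewrite -bilinE1 bilinE2.
have [z' zg'] := rounding (fun j => \sum_i signed_nat (z i) * B i j) un.
move/le_trans; apply; rewrite -bilinE2.
pose F (p : {ffun 'I_m -> bool * 'I_(4 * m).+1} * {ffun 'I_n -> bool * 'I_(4 * n).+1}) :=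
  bilin B (fun i => signed_nat (p.1 i)) (fun j => signed_nat (p.2 j)).
by apply: (le_bigmax_cond _ F (j := (z, z'))); rewrite zg zg'.
Qed.

Lemma grid_max_ge0 m n (B : 'M[R]_(m, n)) : 0 <= grid_max B.
Proof. exact: bigmax_ge_id. Qed.

Lemma bilinZ m n (B : 'M[R]_(m, n)) v u a b :
  bilin B (fun i => a * v i) (fun j => b * u j) = a * b * bilin B v u.
Proof.
rewrite /bilin mulr_sumr; apply: eq_bigr => i _; rewrite mulr_sumr.
by apply: eq_bigr => j _; ring.
Qed.

Lemma sqrt_sumsq_eq0 k (v : 'I_k -> R) : Num.sqrt (\sum_i v i ^+ 2) = 0 -> forall i, v i = 0.
Proof.
move/eqP; rewrite sqrtr_eq0 => h i; apply/eqP; rewrite -sqrf_eq0.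
have /eqP := le_anti (introT andP (conj h (sumr_ge0 _ (fun i _ => sqr_ge0 (v i))))).
by rewrite psumr_eq0 => [/allP/(_ i (mem_index_enum i))|j _]; rewrite ?sqr_ge0.
Qed.

(** By homogeneity, nonzero vectors are rescaled to norms [sqrt m] and [sqrt n]; if one of them is
    zero, both sides vanish. *)
Lemma bilin_le m n (B : 'M[R]_(m, n)) v u : (0 < m)%N -> (0 < n)%N ->
  bilin B v u <= grid_max B / Num.sqrt (m * n)%:R *
    (Num.sqrt (\sum_i v i ^+ 2) * Num.sqrt (\sum_j u j ^+ 2)).
Proof.
move=> m0 n0; set nv := Num.sqrt (\sum_i _); set nu := Num.sqrt (\sum_j _).
have [v0|v0] := eqVneq nv 0.
  rewrite v0 mul0r mulr0 bilinE1 big1 // => i _.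
  by rewrite (sqrt_sumsq_eq0 v0) mulr0.
have [u0|u0] := eqVneq nu 0.
  rewrite u0 !mulr0 bilinE2 big1 // => i _.
  by rewrite (sqrt_sumsq_eq0 u0) mulr0.
have nv0 : 0 < nv by rewrite lt_neqAle eq_sym v0 sqrtr_ge0.
have nu0 : 0 < nu by rewrite lt_neqAle eq_sym u0 sqrtr_ge0.
have sm : 0 < Num.sqrt m%:R :> R by rewrite sqrtr_gt0 ltr0n.
have sn : 0 < Num.sqrt n%:R :> R by rewrite sqrtr_gt0 ltr0n.
have sq k (x : 'I_k -> R) nx : nx = Num.sqrt (\sum_i x i ^+ 2) -> nx != 0 ->
    \sum_i (Num.sqrt k%:R / nx * x i) ^+ 2 <= k%:R.
  move=> -> x0; under eq_bigr do rewrite exprMn.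
  rewrite -mulr_sumr exprMn exprVn !sqr_sqrtr ?ler0n ?sumr_ge0 // => [|i _]; last exact: sqr_ge0.
  rewrite mulfVK //; apply: contra_neq x0 => ->; exact: sqrtr0.
have := bilin_le_grid_max B (sq _ _ _ (erefl nv) v0) (sq _ _ _ (erefl nu) u0).
rewrite bilinZ natrM sqrtrM // => h.
rewrite mulrAC ler_pdivlMr ?mulr_gt0 //.
set a := Num.sqrt m%:R in sm h *; set b := Num.sqrt n%:R in sn h *.
have -> : bilin B v u * (a * b) = nv * nu * (a / nv * (b / nu) * bilin B v u).
  by field; rewrite v0 u0.
by rewrite mulrC ler_wpM2r // mulr_ge0 ?ltW.
Qed.

Lemma sum_half_pow K : \sum_(k < K) (2^-1) ^+ k <= 2 :> R.
Proof.
suff : \sum_(k < K) (2^-1) ^+ k + 2 * (2^-1) ^+ K = 2 :> R.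
  by move=> {2}<-; rewrite lerDl mulr_ge0 // exprn_ge0 // invr_ge0.
elim: K => [|K IHK]; first by rewrite big_ord0 expr0; ring.
by rewrite big_ord_recr /= exprS -[RHS]IHK; field.
Qed.

(** Give a vector the weight [\prod_i 16 / 2 ^ |z i|]. On the grid [\sum_i |z i| <= 4 m], so this
    weight is at least 1, while the total weight of all vectors factorises over the coordinates. *)
Lemma card_grid m : #|grid m|%:R <= 64 ^+ m :> R.
Proof.
pose h (p : bool * 'I_(4 * m).+1) : R := 16 * (2^-1) ^+ p.2.
have h_ge0 p : 0 <= h p by rewrite mulr_ge0 // exprn_ge0 // invr_ge0.
(* [64 = 16 * 2 * 2]: two signs, and a geometric sum below 2. *)
have hsum : \sum_p h p <= 64.
  rewrite /h -mulr_sumr -(pair_bigA _ (fun _ (k : 'I__) => (2^-1) ^+ k)) /=.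
  rewrite sumr_const card_bool.
  by have := sum_half_pow (4 * m).+1; rewrite -mulr_natr; lra.
have -> : #|grid m|%:R = \sum_(z in grid m) 1 :> R by rewrite sumr_const.
apply: (@le_trans _ _ (\sum_(z : {ffun 'I_m -> bool * 'I_(4 * m).+1}) \prod_i h (z i))).
  rewrite [leRHS](bigID (mem (grid m))) /= ler_wpDr ?sumr_ge0 // => [z _|].
    exact: prodr_ge0.
  apply: ler_sum => z; rewrite inE => zg.
  have {}zg : (\sum_i (z i).2 <= 4 * m)%N.
    rewrite -(ler_nat R); apply: le_trans zg; rewrite natr_sum; apply: ler_sum => i _.
    by rewrite signed_nat_sqr ler_nat leq_square.
  rewrite /h big_split /= prodr_const card_ord prodrXr.
  have -> : 16 ^+ m = 2 ^+ (4 * m) :> R by rewrite exprM; congr (_ ^+ _); ring.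
  rewrite exprVn -[leRHS]/(_ / _) ler_pdivlMr ?exprn_gt0 // mul1r.
  by rewrite ler_weXn2l // ler1n.
rewrite -(bigA_distr_bigA (fun=> h)) prodr_const card_ord.
by rewrite lerXn2r ?nnegrE ?sumr_ge0.
Qed.

End Rounding.
Arguments grid : clear implicits.

(** * Sub-Gaussian linear forms in independent variables *)

Section LinearForm.
Variables (R : realType) (I T : finType) (P b : I -> T -> R).
Hypothesis P_ge0 : forall k x, 0 <= P k x.
Hypothesis P_sum1 : forall k, \sum_x P k x = 1.
Hypothesis b_diff : forall k x y, `|b k x - b k y| <= 1.
Hypothesis b_mean0 : forall k, \sum_x P k x * b k x = 0.

Lemma expect_linear (a : I -> R) : expect P (fun w => \sum_k a k * b k (w k)) = 0.
Proof.
rewrite expect_sum big1 // => k _.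
by rewrite expectZ (expect_coord P_sum1) b_mean0 mulr0.
Qed.

Lemma linear_upd (a : I -> R) (w : {ffun I -> T}) k x :
  \sum_j a j * b j (upd w k x j) - \sum_j a j * b j (w j) = a k * (b k x - b k (w k)).
Proof.
rewrite -sumrB (bigD1 k) //= big1 ?addr0 => [|j jk]; first by rewrite ffunE eqxx mulrBr.
by rewrite ffunE (negPf jk) subrr.
Qed.

(** Resampling the coordinate [k] moves the form by at most [|a k|], so [mcdiarmid] applies, with
    mean zero. *)
Lemma linear_mgf (a : I -> R) :
  expect P (fun w => expR (\sum_k a k * b k (w k))) <= expR (2 * \sum_k a k ^+ 2).
Proof.
have bd : bounded_diff (fun k => `|a k|) (fun w : {ffun I -> T} => \sum_k a k * b k (w k)).
  by move=> k w x; rewrite linear_upd normrM ler_piMr.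
apply: le_trans (mcdiarmid P_ge0 P_sum1 bd) _; rewrite expect_linear addr0.
by under eq_bigr do rewrite real_normK ?num_real //.
Qed.

End LinearForm.

Lemma bilinE (R : realType) m n (B : 'M[R]_(m, n)) v u :
  bilin B v u = \sum_(k : 'I_m * 'I_n) v k.1 * u k.2 * B k.1 k.2.
Proof.
rewrite -(pair_bigA _ (fun i j => v i * u j * B i j)) /=.
by apply: eq_bigr => i _; apply: eq_bigr => j _; rewrite mulrAC.
Qed.

Lemma expect_grid_max (R : realType) (m n : nat) (T : finType)
    (P b : 'I_m * 'I_n -> T -> R) : (0 < m)%N -> (0 < n)%N ->
  (forall k x, 0 <= P k x) -> (forall k, \sum_x P k x = 1) ->
  (forall k x y, `|b k x - b k y| <= 1) -> (forall k, \sum_x P k x * b k x = 0) ->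
  expect P (fun w => grid_max (\matrix_(i, j) b (i, j) (w (i, j))))
    <= 39 * Num.sqrt (m + n)%:R * Num.sqrt (m * n)%:R.
Proof.
move=> m0 n0 P0 P1 bd b0.
set s : R := Num.sqrt (m + n)%:R; set q : R := Num.sqrt (m * n)%:R.
have s0 : 0 < s by rewrite sqrtr_gt0 ltr0n addn_gt0 m0.
have q0 : 0 < q by rewrite sqrtr_gt0 ltr0n muln_gt0 m0.
have s2 : s ^+ 2 = (m + n)%:R by rewrite sqr_sqrtr.
have q2 : q ^+ 2 = (m * n)%:R by rewrite sqr_sqrtr.
pose A : {pred {ffun 'I_m -> bool * 'I_(4 * m).+1} * {ffun 'I_n -> bool * 'I_(4 * n).+1}} :=
  [pred p | (p.1 \in grid R m) && (p.2 \in grid R n)].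
(* With this choice the exponent [2 * lam ^+ 2 * (4 m) * (4 n)] becomes [32 (m + n)], of the same
   order as the logarithm of the number of grid pairs. *)
pose lam := s / q.
have lam0 : 0 < lam by rewrite divr_gt0.
pose F (p : {ffun 'I_m -> bool * 'I_(4 * m).+1} * {ffun 'I_n -> bool * 'I_(4 * n).+1})
  (w : {ffun 'I_m * 'I_n -> T}) : R :=
  bilin (\matrix_(i, j) b (i, j) (w (i, j)))
    (fun i => signed_nat R (p.1 i)) (fun j => signed_nat R (p.2 j)).
have Fc p : p \in A -> expect P (fun w => expR (lam * F p w)) <= expR (32 * s ^+ 2).
  case: p => z z' /andP[/= zg zg'].
  pose a (k : 'I_m * 'I_n) := lam * (signed_nat R (z k.1) * signed_nat R (z' k.2)).
  apply: (@le_trans _ _ (expR (2 * \sum_k a k ^+ 2))).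
    apply: le_trans _ (linear_mgf P0 P1 bd b0 a); rewrite le_eqVlt; apply/orP; left.
    apply/eqP/eq_expect => w; rewrite /F bilinE mulr_sumr; congr expR.
    by apply: eq_bigr => -[i j] _; rewrite mxE mulrA.
  rewrite ler_expR.
  have -> : \sum_k a k ^+ 2 = lam ^+ 2 *
     ((\sum_i signed_nat R (z i) ^+ 2) * (\sum_j signed_nat R (z' j) ^+ 2)).
    rewrite big_distrlr /= pair_bigA mulr_sumr /=.
    by apply: eq_bigr => -[i j] _; rewrite /a !exprMn.
  have : (\sum_i signed_nat R (z i) ^+ 2) * (\sum_j signed_nat R (z' j) ^+ 2)
      <= (4 * m)%:R * (4 * n)%:R.
    by apply: ler_pM => //; apply: sumr_ge0 => i _; apply: sqr_ge0.
  rewrite !natrM => /(ler_wpM2l (sqr_ge0 lam)) h.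
  have : lam ^+ 2 * q ^+ 2 = s ^+ 2 by rewrite -exprMn mulfVK ?gt_eqF.
  by rewrite q2 natrM; lra.
have cardA : #|A|%:R <= 64 ^+ (m + n) :> R.
  have -> : #|A| = (#|grid R m| * #|grid R n|)%N.
    by rewrite -cardX; apply: eq_card => p; rewrite !inE.
  by rewrite natrM exprD ler_pM ?card_grid.
have e2 : 2 <= expR 1 :> R by have := @expR_ge1Dx R 1; lra.
have e64 : 64 ^+ (m + n) <= expR (6 * s ^+ 2) :> R.
  rewrite s2 expRM_natr lerXn2r ?nnegrE ?expR_ge0 //.
  have -> : 64 = 2 ^+ 6 :> R by ring.
  by rewrite -[6]mulr1 expRM_natl lerXn2r ?nnegrE ?expR_ge0.
have s1 : 1 <= s ^+ 2 by rewrite s2 ler1n addn_gt0 m0.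
(* [39 = 32 + 6 + 1]: moment generating function, cardinality [64 <= expR 6] per coordinate, and one
   unit for the leading 1, as [2 <= expR (s ^+ 2)]. *)
have tot : 1 + #|A|%:R * expR (32 * s ^+ 2) <= expR (39 * s ^+ 2).
  have h : #|A|%:R * expR (32 * s ^+ 2) <= expR (38 * s ^+ 2).
    have -> : 38 * s ^+ 2 = 6 * s ^+ 2 + 32 * s ^+ 2 by ring.
    by rewrite expRD ler_pM2r ?expR_gt0 // (le_trans cardA).
  have -> : 39 * s ^+ 2 = s ^+ 2 + 38 * s ^+ 2 by ring.
  have h1 : 1 <= expR (38 * s ^+ 2) by have := expR_ge1Dx (38 * s ^+ 2); lra.
  have h2 : 2 <= expR (s ^+ 2) by have := expR_ge1Dx (s ^+ 2); lra.
  by rewrite expRD; nra.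
have fin := expect_bigmax P0 P1 Fc tot.
rewrite -(ler_pM2l lam0).
have -> : lam * (39 * s * q) = 39 * s ^+ 2 by rewrite /lam; field; rewrite gt_eqF.
by apply: le_trans fin.
Qed.

(** * Trace duality for the nuclear norm *)

Lemma char_poly_conj (F : fieldType) n (U D : 'M[F]_n) : U \in unitmx ->
  char_poly (invmx U *m D *m U) = char_poly D.
Proof.
move=> Uu; rewrite /char_poly.
have UV : map_mx polyC (invmx U) *m map_mx polyC U = 1%:M.
  by rewrite -map_mxM mulVmx // map_mx1.
have -> : char_poly_mx (invmx U *m D *m U) =
    map_mx polyC (invmx U) *m char_poly_mx D *m map_mx polyC U.
  rewrite /char_poly_mx !map_mxM mulmxBr mulmxBl; congr (_ - _).
  by rewrite mul_mx_scalar -scalemxAl UV scale_scalar_mx mulr1.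
rewrite !det_mulmx mulrAC -det_mulmx UV det1 mul1r //.
Qed.

(** * Spectral decomposition of the Gram matrix through complex numbers *)

Section ComplexParts.
Variable R : realType.
Notation re := (@complex.Re R).
Notation im := (@complex.Im R).

Lemma Re_sum (I : finType) (F : I -> R[i]) : re (\sum_i F i) = \sum_i re (F i).
Proof. by apply: (big_morph re) => // -[a b] [c d]. Qed.

Lemma Im_sum (I : finType) (F : I -> R[i]) : im (\sum_i F i) = \sum_i im (F i).
Proof. by apply: (big_morph im) => // -[a b] [c d]. Qed.

Lemma Re_mul_conj (x y : R[i]) : re (x * y^*%R) = re x * re y + im x * im y.
Proof. by case: x y => [a b] [c d] /=; rewrite mulrN opprK. Qed.

Lemma conj_mul_Re (x y : R[i]) : re (x^*%R * y) = re x * re y + im x * im y.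
Proof. by case: x y => [a b] [c d] /=; rewrite mulNr opprK. Qed.

Lemma Re_mul_real (x : R[i]) (a : R) : re (x * real_complex R a) = re x * a.
Proof. by case: x => b c /=; rewrite mulr0 subr0. Qed.

Lemma Im_mul_real (x : R[i]) (a : R) : im (x * real_complex R a) = im x * a.
Proof. by case: x => b c /=; rewrite mulr0 add0r. Qed.

Lemma conj_real (a : R) : (real_complex R a)^*%R = real_complex R a.
Proof. exact: conjc_real. Qed.
End ComplexParts.

Local Notation conjC := Num.Def.conjC.

(* The real and imaginary parts [p], [q] of a unitary eigenbasis stand in for a real
   spectral theorem. *)
Lemma gram_spectral (R : realType) m n (X : 'M[R]_(m, n)) :
  exists p q : 'M[R]_n, exists d : 'rV[R]_n,
  [/\ forall i, \sum_j p i j ^+ 2 + \sum_j q i j ^+ 2 = 1,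
      p^T *m p + q^T *m q = 1%:M,
      forall i, \sum_a (p *m X^T) i a ^+ 2 + \sum_a (q *m X^T) i a ^+ 2 = d 0 i
    & char_poly (X^T *m X) = \prod_i ('X - (d 0 i)%:P)].
Proof.
pose f := real_complex R; pose Xc := map_mx f X.
pose H := Xc^T *m Xc.
have XcE : map_mx conjC Xc = Xc by apply/matrixP => i j; rewrite !mxE conj_real.
have XcTE : map_mx conjC Xc^T = Xc^T by rewrite -map_trmx XcE.
have Hn : H \is normalmx.
  apply: hermitian_normalmx; apply/is_hermitianmxP.
  by rewrite expr0 scale1r /H trmx_mul trmxK map_mxM XcE XcTE.
have /orthomx_spectralP := Hn; set U := spectralmx H; set D := spectral_diag H => HE.
have Uu : U \is unitarymx := spectral_unitarymx H.
have Uunit := unitarymx_unit Uu.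
have UU : U *m map_mx conjC U^T = 1%:M by apply/unitarymxP.
have UU' : map_mx conjC U^T *m U = 1%:M by rewrite -invmx_unitary // mulVmx.
(* The spectral decomposition, solved for [D], shows it as the Gram matrix of the rows of
   [U *m Xc^T]; its diagonal consists of their squared norms. *)
have diagE : diag_mx D = (U *m Xc^T) *m map_mx conjC (U *m Xc^T)^T.
  rewrite trmx_mul trmxK map_mxM XcE -invmx_unitary // mulmxA -(mulmxA U) -/H HE.
  by rewrite -mulmxA mulmxK // mulKVmx.
pose p := map_mx (@complex.Re R) U; pose q := map_mx (@complex.Im R) U.
pose d := map_mx (@complex.Re R) D.
have pX i a : (p *m X^T) i a = complex.Re ((U *m Xc^T) i a).
  by rewrite !mxE Re_sum; apply: eq_bigr => j _; rewrite !mxE Re_mul_real.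
have qX i a : (q *m X^T) i a = complex.Im ((U *m Xc^T) i a).
  by rewrite !mxE Im_sum; apply: eq_bigr => j _; rewrite !mxE Im_mul_real.
have dE i : \sum_a (p *m X^T) i a ^+ 2 + \sum_a (q *m X^T) i a ^+ 2 = d 0 i.
  have /matrixP/(_ i i)/(congr1 (@complex.Re R)) := diagE.
  rewrite [in RHS]mxE Re_sum mxE eqxx mulr1n mxE => ->.
  rewrite -big_split /=; apply: eq_bigr => a _.
  by rewrite pX qX [map_mx _ _ _ _]mxE [_^T _ _]mxE Re_mul_conj.
(* The eigenvalues are real, being diagonal entries of a Gram matrix. *)
have D_d i : D 0 i = f (d 0 i).
  have /matrixP/(_ i i) := diagE; rewrite mxE eqxx mulr1n => Dii.
  suff : complex.Im (D 0 i) = 0 by rewrite mxE; case: (D 0 i) => a b /= ->.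
  rewrite Dii mxE Im_sum big1 // => a _; rewrite [map_mx _ _ _ _]mxE [_^T _ _]mxE.
  by case: (_ i a) => b c /=; ring.
exists p, q, d; split => //.
- move=> i; have /matrixP/(_ i i)/(congr1 (@complex.Re R)) := UU.
  rewrite !mxE eqxx Re_sum => e1; rewrite -[1]/(complex.Re (1 : R[i])) -e1 -big_split.
  apply: eq_bigr => j _ /=.
  by rewrite [map_mx _ _ _ _]mxE [_^T _ _]mxE Re_mul_conj !mxE.
- apply/matrixP => j k; have /matrixP/(_ j k)/(congr1 (@complex.Re R)) := UU'.
  rewrite !mxE Re_sum; have -> : complex.Re ((j == k)%:R : R[i]) = (j == k)%:R by case: eqP.
  move=> <-; rewrite -big_split; apply: eq_bigr => i _ /=.
  by rewrite !mxE conj_mul_Re.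
- apply: (@map_poly_inj _ _ (real_complex R)).
  rewrite map_char_poly map_mxM -map_trmx -/f -/Xc -/H HE char_poly_conj //.
  rewrite char_poly_trig ?diag_mx_is_trig // rmorph_prod /=.
  apply: eq_bigr => i _; rewrite mxE eqxx mulr1n D_d rmorphB /= map_polyX map_polyC //.
Qed.

(** [nuclear_norm] chooses some list of singular values. Its squares and [d] are the roots of the
    same split polynomial, hence agree up to a permutation, which leaves the sum unchanged. *)
Lemma nuclear_norm_gram (R : realType) m n (X : 'M[R]_(m, n)) (d : 'rV[R]_n) :
  (forall i, 0 <= d 0 i) -> char_poly (X^T *m X) = \prod_i ('X - (d 0 i)%:P) ->
  nuclear_norm X = \sum_i Num.sqrt (d 0 i).
Proof.
move=> d0 dE; rewrite /nuclear_norm.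
(* The square roots of [d] witness that the choice is not the default 0 of an empty set. *)
have : singular_values X (xget 0 [set sv | singular_values X sv]).
  apply: (@xgetPex _ _ [set sv | singular_values X sv]).
  exists (\row_i Num.sqrt (d 0 i)); split => [i|]; first by rewrite mxE sqrtr_ge0.
  by rewrite dE; apply: eq_bigr => i _; rewrite mxE sqr_sqrtr.
set sv := xget _ _ => -[sv0 svE].
have pe : perm_eq [seq d 0 i | i <- index_enum 'I_n] [seq sv 0 i ^+ 2 | i <- index_enum 'I_n].
  by apply: prod_XsubC_eq; rewrite !big_map -dE.
rewrite (eq_bigr (fun i => Num.sqrt (sv 0 i ^+ 2))) => [|i _]; last first.
  by rewrite sqrtr_sqr ger0_norm.
have := perm_big _ pe (op := +%R) (x := 0) (P := xpredT) (F := @Num.sqrt R).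
by rewrite !big_map.
Qed.

(** Cauchy-Schwarz in the plane, meant for recombining real and imaginary parts; after squaring, the
    defect is [(x t - z y)^2]. *)
Lemma sqrt_cauchy_schwarz (R : realType) (a b c d : R) :
  0 <= a -> 0 <= b -> 0 <= c -> 0 <= d ->
  Num.sqrt a * Num.sqrt b + Num.sqrt c * Num.sqrt d <= Num.sqrt (a + c) * Num.sqrt (b + d).
Proof.
have sqrtP (x : R) : 0 <= x -> exists2 y, 0 <= y & x = y ^+ 2.
  by move=> x0; exists (Num.sqrt x); rewrite ?sqrtr_ge0 ?sqr_sqrtr.
move=> /sqrtP[x x0 ->] /sqrtP[y y0 ->] /sqrtP[z z0 ->] /sqrtP[t t0 ->].
rewrite !sqrtr_sqr !ger0_norm // -sqrtrM ?addr_ge0 ?sqr_ge0 //.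
rewrite -ler_sqr ?nnegrE ?sqrtr_ge0 ?addr_ge0 ?mulr_ge0 //.
rewrite sqr_sqrtr ?mulr_ge0 ?addr_ge0 ?sqr_ge0 //.
by have := sqr_ge0 (x * t - z * y); nra.
Qed.

(* With [u_i] a unitary eigenbasis of [X^T X], [<B, X>] is the sum of the
   [<B u_i, X u_i>], and [|X u_i|] is the i-th singular value. *)
Lemma nuclear_pairing (R : realType) m n (B X : 'M[R]_(m, n)) (K : R) : 0 <= K ->
  (forall v u, bilin B v u
     <= K * (Num.sqrt (\sum_i v i ^+ 2) * Num.sqrt (\sum_j u j ^+ 2))) ->
  \sum_i \sum_j B i j * X i j <= K * nuclear_norm X.
Proof.
move=> K0 BK; have [p [q [d [pq1 pq dE Xd]]]] := gram_spectral X.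
have sq k (v : 'I_k -> R) : 0 <= \sum_i v i ^+ 2.
  by apply: sumr_ge0 => i _; apply: sqr_ge0.
have d0 i : 0 <= d 0 i by rewrite -dE addr_ge0.
rewrite (nuclear_norm_gram d0 Xd) mulr_sumr.
pose g (r : 'M[R]_n) i := bilin B ((r *m X^T) i) (r i).
have gE r : \sum_i g r i = \tr (B^T *m X *m (r^T *m r)).
  have -> : \tr (B^T *m X *m (r^T *m r)) = \tr ((r *m X^T) *m B *m r^T).
    rewrite -mxtrace_tr !trmx_mul !trmxK -!mulmxA mxtrace_mulC -!mulmxA.
    by rewrite mxtrace_mulC !mulmxA.
  by apply: eq_bigr => i _; rewrite mxE /g bilinE2; apply: eq_bigr => j _; rewrite !mxE.
(* The traces for [p] and [q] add up to [\tr (B^T *m X)] because [p^T *m p + q^T *m q = 1%:M]. *)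
have -> : \sum_i \sum_j B i j * X i j = \sum_i (g p i + g q i).
  rewrite big_split /= !gE -mxtraceD -mulmxDr pq mulmx1 exchange_big.
  apply: eq_bigr => j _; rewrite mxE; apply: eq_bigr => i _; rewrite mxE //.
apply: ler_sum => i _; apply: le_trans (lerD (BK _ _) (BK _ _)) _.
rewrite -mulrDr ler_wpM2l //; apply: le_trans (sqrt_cauchy_schwarz _ _ _ _) _ => //.
by rewrite dE pq1 sqrtr1 mulr1.
Qed.

(** * Deviation of the empirical error *)

Section SupremumTail.
Variables (R : realType) (I T : finType) (P b : I -> T -> R).
Hypothesis P_ge0 : forall k x, 0 <= P k x.
Hypothesis P_sum1 : forall k, \sum_x P k x = 1.
Hypothesis b_diff : forall k x y, `|b k x - b k y| <= 1.

(** Every member of the family moves by at most 1, hence so does the supremum; the majorant [H]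
    makes the suprema finite. *)
Lemma bounded_diff_sup (S : set (I -> R)) (H : {ffun I -> T} -> R) :
  (exists a, S a) -> (forall a k, S a -> `|a k| <= 1) ->
  (forall a (w : {ffun I -> T}), S a -> \sum_k a k * b k (w k) <= H w) ->
  bounded_diff (fun=> 1)
    (fun w : {ffun I -> T} => sup [set \sum_k a k * b k (w k) | a in S]%classic).
Proof.
move=> [a0 Sa0] Sle1 SH.
pose V (w : {ffun I -> T}) := [set \sum_k a k * b k (w k) | a in S]%classic.
have supV w : has_sup (V w).
  split; first by exists (\sum_k a0 k * b k (w k)), a0.
  by exists (H w) => _ [a Sa <-]; apply: SH.
have step (w w' : {ffun I -> T}) : (forall a, S a ->
    \sum_j a j * b j (w j) <= \sum_j a j * b j (w' j) + 1) ->
    sup (V w) <= sup (V w') + 1.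
  move=> h; apply: ge_sup; first by case: (supV w).
  move=> _ [a Sa <-]; apply: le_trans (h a Sa) _; rewrite lerD2r.
  by apply: ub_le_sup; [case: (supV w')|exists a].
have dif a (w : {ffun I -> T}) k x : S a ->
    `|\sum_j a j * b j (upd w k x j) - \sum_j a j * b j (w j)| <= 1.
  move=> Sa; rewrite linear_upd normrM -[1]mulr1.
  by apply: ler_pM; rewrite // Sle1.
move=> k w x; rewrite ler_distlC lerBlDr.
apply/andP; split; apply: step => a Sa;
  by have := dif a w k x Sa; rewrite ler_distlC => /andP[]; lra.
Qed.

(** Chernoff's bound for the supremum [F]: its differences are controlled by [bounded_diff_sup] and
    its mean by that of the majorant [H]. *)
Lemma sup_linear_tail (S : set (I -> R)) (H : {ffun I -> T} -> R) (h l : R) :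
  (0 < #|I|)%N -> 0 < l -> (forall a k, S a -> `|a k| <= 1) ->
  (forall a (w : {ffun I -> T}), S a -> \sum_k a k * b k (w k) <= H w) -> expect P H <= h ->
  expect P (fun w => (`[< exists2 a, S a &
     h + 3 * Num.sqrt (#|I|%:R * l) < \sum_k a k * b k (w k) >])%:R) <= expR (- l).
Proof.
move=> I0 l0 Sle1 SH Hh; set N : R := #|I|%:R.
have N0 : 0 < N by rewrite ltr0n.
have [[a0 Sa0]|nS] := pselect (exists a, S a); last first.
  rewrite -[leRHS](expect_cst P_sum1); apply: le_expect => // w.
  by case: asboolP => [[a Sa]|_]; rewrite ?expR_ge0 //; case: nS; exists a.
pose F (w : {ffun I -> T}) := sup [set \sum_k a k * b k (w k) | a in S]%classic.
have le_F a (w : {ffun I -> T}) : S a -> \sum_k a k * b k (w k) <= F w.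
  move=> Sa; apply: ub_le_sup; last by exists a.
  by exists (H w) => _ [a' Sa' <-]; apply: SH.
have F_le w : F w <= H w.
  apply: ge_sup; first by exists (\sum_k a0 k * b k (w k)), a0.
  by move=> _ [a' Sa' <-]; apply: SH.
set u := 3 * Num.sqrt (N * l).
(* The minimiser of [2 * N * lam ^+ 2 - lam * u]; the minimum is [- 9 / 8 * l], which is below
   [- l]. *)
pose lam := 3 / 4 * Num.sqrt (l / N).
have lam0 : 0 <= lam by rewrite mulr_ge0 ?sqrtr_ge0 // divr_ge0.
have bd : bounded_diff (fun=> lam) (fun w : {ffun I -> T} => lam * F w).
  move=> k w x; rewrite -mulrBr normrM ger0_norm // ler_piMr //.
  exact: (bounded_diff_sup (ex_intro _ a0 Sa0) Sle1 SH).
have mgf : expect P (fun w => expR (lam * F w)) <= expR (2 * (N * lam ^+ 2) + lam * h).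
  apply: le_trans (mcdiarmid P_ge0 P_sum1 bd) _.
  rewrite ler_expR expectZ sumr_const -[lam ^+ 2 *+ _]mulr_natl lerD2l ler_wpM2l //.
  exact: le_trans (le_expect P_ge0 F_le) Hh.
have lam2 : N * lam ^+ 2 = 9 / 16 * l.
  rewrite exprMn sqr_sqrtr ?divr_ge0 ?ltW //; field; exact: lt0r_neq0.
have lamu : lam * u = 9 / 4 * l.
  rewrite /lam /u mulrACA -sqrtrM ?divr_ge0 ?ltW //.
  have -> : l / N * (N * l) = l ^+ 2 by field; exact: lt0r_neq0.
  by rewrite sqrtr_sqr ger0_norm ?ltW //; field.
apply: (@le_trans _ _ (expect P (fun w => expR (- (lam * (h + u))) * expR (lam * F w)))).
  apply: le_expect => // w; case: asboolP => [[a Sa hu]|_]; last first.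
    by rewrite mulr_ge0 ?expR_ge0.
  rewrite -expRD -[leLHS]expR0 ler_expR addrC subr_ge0 ler_wpM2l //.
  exact: le_trans (ltW hu) (le_F a w Sa).
rewrite expectZ; apply: le_trans (ler_wpM2l (expR_ge0 _) mgf) _.
by rewrite -expRD ler_expR mulrDr lamu lam2; lra.
Qed.

End SupremumTail.

(** * The observation model and its centred noise *)

Section Observation.
Variables (R : realType) (m n : nat) (M : 'M[R]_(m, n)) (rho : R).
Hypothesis M01 : forall i j, 0 <= M i j <= 1.
Hypothesis rho_ge0 : 0 <= rho.
Hypothesis rho_lt1 : rho < 1.

(** The factor of [prob] at the entry [k], so that [prob M rho] is [weight entry_law] by
    conversion. *)
Definition entry_law (k : 'I_m * 'I_n) (x : bool * bool) : R :=
  (if x.1 then M k.1 k.2 else 1 - M k.1 k.2) * (if x.2 then 1 - rho else rho).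

Definition entry_noise (k : 'I_m * 'I_n) (x : bool * bool) : R :=
  (x.1 && x.2)%:R - M k.1 k.2 * (1 - rho).

Lemma entry_law_ge0 k x : 0 <= entry_law k x.
Proof.
have /andP[M0 M1] := M01 k.1 k.2.
by apply: mulr_ge0; case: ifP => _ //; rewrite subr_ge0 // ltW.
Qed.

Lemma sum_bool2 (F : bool * bool -> R) :
  \sum_x F x = F (true, true) + F (true, false) + (F (false, true) + F (false, false)).
Proof.
rewrite (eq_bigr (fun x => F (x.1, x.2))) => [|[]//].
by rewrite -(pair_bigA _ (fun a b => F (a, b))) /= !big_bool.
Qed.

Lemma entry_law_sum1 k : \sum_x entry_law k x = 1.
Proof. by rewrite sum_bool2 /entry_law /=; ring. Qed.

Lemma entry_noise_mean0 k : \sum_x entry_law k x * entry_noise k x = 0.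
Proof. by rewrite sum_bool2 /entry_law /entry_noise /=; ring. Qed.

Lemma entry_noise_diff k x y : `|entry_noise k x - entry_noise k y| <= 1.
Proof.
rewrite /entry_noise opprB addrA subrK.
by case: (_ && _); case: (_ && _); rewrite ?subrr ?subr0 ?sub0r ?normrN ?normr1 ?normr0.
Qed.

Lemma PrE (E : Omega m n -> Prop) : Pr M rho E = expect entry_law (fun w => (`[< E w >])%:R).
Proof.
rewrite /Pr big_mkcond; apply: eq_bigr => w _.
by case: asboolP => _; rewrite ?mulr1 ?mulr0.
Qed.

(** [ltilde] is affine in the label, namely [x^2 + a (1 - 2 x) / (1 - rho)]; writing [a] as its mean
    plus [entry_noise] separates the expected error from the fluctuation. *)
Lemma RhatE (X : 'M[R]_(m, n)) (w : Omega m n) :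
  Rhat rho X w =
    (m * n)%:R^-1 * (\sum_k (X k.1 k.2 ^+ 2 + M k.1 k.2 * (1 - 2 * X k.1 k.2)))
    + (m * n)%:R^-1 / (1 - rho) * \sum_k (1 - 2 * X k.1 k.2) * entry_noise k (w k).
Proof.
have r0 : 1 - rho != 0 by rewrite subr_eq0 gt_eqF.
rewrite /Rhat pair_bigA /= -[_ / _ * _]mulrA -mulrDr [(1 - rho)^-1 * _]mulr_sumr.
rewrite -big_split /=; congr (_ * _).
apply: eq_bigr => -[i j] _ /=; rewrite /ltilde /Amat /entry_noise /=.
by case: (_ && _) => /=; field.
Qed.

Lemma ER_sub_Rhat (X : 'M[R]_(m, n)) (w : Omega m n) :
  ER M rho X - Rhat rho X w =
    - ((m * n)%:R^-1 / (1 - rho) * \sum_k (1 - 2 * X k.1 k.2) * entry_noise k (w k)).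
Proof.
have -> : ER M rho X = expect entry_law (Rhat rho X) by [].
rewrite (eq_expect _ (RhatE X)) expectD (expect_cst entry_law_sum1) expectZ.
rewrite (expect_linear entry_law_sum1 entry_noise_mean0 (fun k => 1 - 2 * X k.1 k.2)).
by rewrite RhatE; ring.
Qed.

End Observation.

Lemma bilinN (R : realType) m n (B : 'M[R]_(m, n)) v u :
  bilin (- B) v u = bilin B (fun i => - v i) u.
Proof.
by apply: eq_bigr => i _; apply: eq_bigr => j _; rewrite mxE mulrN !mulNr.
Qed.

(** Trace duality is used for [B] and for [- B]; in the latter case the sign moves onto [v], whose
    norm does not change. *)
Lemma pairing_le_grid_max (R : realType) m n (B X : 'M[R]_(m, n)) (t : R) :
  (0 < m)%N -> (0 < n)%N -> nuclear_norm X <= t ->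
  `|\sum_i \sum_j B i j * X i j| <= grid_max B / Num.sqrt (m * n)%:R * t.
Proof.
move=> m0 n0 Xt; set K := _ / _.
have K0 : 0 <= K by rewrite divr_ge0 ?sqrtr_ge0 ?grid_max_ge0.
have BK v u := bilin_le B v u m0 n0.
apply: le_trans (ler_wpM2l K0 Xt); rewrite ler_norml lerNl.
apply/andP; split; last exact: nuclear_pairing.
rewrite (_ : - _ = \sum_i \sum_j (- B) i j * X i j).
  apply: nuclear_pairing => // v u; rewrite bilinN; apply: le_trans (BK _ _) _.
  by under eq_bigr do rewrite sqrrN.
by rewrite -sumrN; apply: eq_bigr => i _; rewrite -sumrN; apply: eq_bigr => j _; rewrite mxE mulNr.
Qed.

(** The sign [e] selects one of the two sides of the deviation, to which [sup_linear_tail]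
    applies. *)
Lemma deviation_tail (R : realType) (m n : nat) (M : 'M[R]_(m, n)) (rho t l e : R) :
  (0 < m)%N -> (0 < n)%N -> (forall i j, 0 <= M i j <= 1) -> 0 <= rho -> rho < 1 ->
  0 < t -> 0 < l -> `|e| = 1 ->
  expect (entry_law M rho) (fun w => (`[< exists2 X, Xset t X &
      78 * t * Num.sqrt (m + n)%:R + 3 * Num.sqrt ((m * n)%:R * l)
        < e * \sum_k (1 - 2 * X k.1 k.2) * entry_noise M rho k (w k) >])%:R) <= expR (- l).
Proof.
move=> m0 n0 M01 rho0 rho1 t0 l0 e1.
have P0 := entry_law_ge0 M01 rho0 rho1; have P1 := entry_law_sum1 M rho.
have bd := entry_noise_diff M rho; have b0 := entry_noise_mean0 M rho.
set P := entry_law M rho in P0 P1 b0 *; set b := entry_noise M rho in bd b0 *.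
pose S : set ('I_m * 'I_n -> R) :=
  [set a | exists2 X, Xset t X & forall k, a k = e * (1 - 2 * X k.1 k.2)]%classic.
pose B (w : {ffun 'I_m * 'I_n -> bool * bool}) : 'M[R]_(m, n) :=
  \matrix_(i, j) b (i, j) (w (i, j)).
pose q : R := Num.sqrt (m * n)%:R.
have q0 : 0 < q by rewrite sqrtr_gt0 ltr0n muln_gt0 m0.
(* The constant part of [1 - 2 X] contributes a sum of mean zero, kept as it is; only [2 X] goes
   through trace duality. *)
pose H (w : {ffun 'I_m * 'I_n -> bool * bool}) := \sum_k e * b k (w k) + 2 * t / q * grid_max (B w).
have Sle1 a k : S a -> `|a k| <= 1.
  move=> [X [_ X01] ->]; rewrite normrM e1 mul1r.
  by have := X01 k.1 k.2 => /andP[]; rewrite ler_norml; lra.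
have SH a (w : {ffun 'I_m * 'I_n -> bool * bool}) : S a -> \sum_k a k * b k (w k) <= H w.
  move=> [X [Xt _] aE].
  have := pairing_le_grid_max (B w) m0 n0 Xt; rewrite pair_bigA /= -/q.
  set s := \sum_p _ => s_le.
  have -> : \sum_k a k * b k (w k) = \sum_k e * b k (w k) - 2 * (e * s).
    rewrite !mulr_sumr -sumrB; apply: eq_bigr => -[i j] _.
    by rewrite aE mxE /=; ring.
  have es : `|e * s| <= grid_max (B w) / q * t by rewrite normrM e1 mul1r.
  rewrite /H lerD2l; have : - (e * s) <= grid_max (B w) / q * t.
    by rewrite (le_trans (ler_norm _)) // normrN.
  have -> : 2 * t / q * grid_max (B w) = 2 * (grid_max (B w) / q * t) by ring.
  by lra.
(* [78 = 2 * 39], and the factor [q] of [expect_grid_max] cancels. *)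
have EH : expect P H <= 78 * t * Num.sqrt (m + n)%:R.
  rewrite expectD expectZ (expect_linear P1 b0 (fun=> e)) add0r.
  have := expect_grid_max m0 n0 P0 P1 bd b0; rewrite -/q => h.
  have : 0 <= 2 * t / q by rewrite divr_ge0 ?mulr_ge0 ?ltW.
  move=> /ler_wpM2l/(_ _ _ h)/le_trans; apply.
  rewrite le_eqVlt; apply/orP; left; apply/eqP; field; exact: lt0r_neq0.
have I0 : (0 < #|{: 'I_m * 'I_n}|)%N by rewrite card_prod !card_ord muln_gt0 m0.
apply: le_trans (sup_linear_tail P0 P1 bd I0 l0 Sle1 SH EH).
apply: le_expect => // w; rewrite card_prod !card_ord ler_nat.
case: asboolP => // -[X Xt lt]; case: asboolP => // -[].
exists (fun k => e * (1 - 2 * X k.1 k.2)); first by exists X.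
apply: lt_le_trans lt _; rewrite mulr_sumr; apply: ler_sum => k _.
by rewrite mulrA.
Qed.

Theorem theorem3 (R : realType) :
  exists C : R,
  forall (m n : nat) (M : 'M[R]_(m, n)) (rho t delta : R),
    (0 < m)%N -> (0 < n)%N ->
    (forall i j, 0 <= M i j <= 1) ->
    0 <= rho -> rho < 1 -> 0 < t -> 0 < delta -> delta < 1 ->
    Pr M rho (fun w =>
      forall X : 'M[R]_(m, n), Xset t X ->
        `| ER M rho X - Rhat rho X w |
          <= t * C * (Num.sqrt n%:R + Num.sqrt m%:R + Num.sqrt (Num.sqrt (s_ones w)%:R))
               / ((1 - rho) * (m * n)%:R)
             + 3 * Num.sqrt (ln (2 / delta)) / (Num.sqrt (m * n)%:R * (1 - rho)))
    >= 1 - delta.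
Proof.
exists 78 => m n M rho t delta m0 n0 M01 rho0 rho1 t0 d0 d1.
(* Each of the two one-sided tails then has probability at most [expR (- l) = delta / 2]. *)
pose l := ln (2 / delta).
have l0 : 0 < l by rewrite ln_gt0 // ltr_pdivlMr // mul1r (lt_trans d1) // ltr1n.
have el : expR (- l) = delta / 2.
  by rewrite expRN lnK ?invf_div // posrE divr_gt0.
have P0 := entry_law_ge0 M01 rho0 rho1; have P1 := entry_law_sum1 M rho.
have tail := deviation_tail m0 n0 M01 rho0 rho1 t0 l0; rewrite el in tail.
have tail1 := tail 1 (normr1 R); have tail2 := tail (-1) (normrN1 R).
set f1 := (fun w => _) in tail1; set f2 := (fun w => _) in tail2.
rewrite PrE; set f := (fun w => _).
(* Union bound: every outcome satisfies the desired inequality or lies in one of the two tail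
   events. *)
suff : 1 <= expect (entry_law M rho) (fun w => f w + (f1 w + f2 w)).
  by rewrite !expectD; lra.
rewrite -[leLHS](expect_cst P1); apply: le_expect => // w.
rewrite /f /f1 /f2; case: asboolP => [_|nf]; first by rewrite lerDl addr_ge0.
rewrite add0r; case: asboolP => [_|n1]; first by rewrite lerDl.
rewrite add0r; case: asboolP => [//|n2]; case: nf => X XS.
have r0 : 0 < 1 - rho by rewrite subr_gt0.
have mn0 : 0 < (m * n)%:R :> R by rewrite ltr0n muln_gt0 m0.
set q : R := (m * n)%:R in mn0 *.
have c0 : 0 <= q^-1 / (1 - rho) by rewrite divr_ge0 ?invr_ge0 ?ltW.
rewrite ER_sub_Rhat // normrN normrM -/q ger0_norm //; set s := \sum_k _.
set r := Num.sqrt (m + n)%:R in n1 n2.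
have s_le : `|s| <= 78 * t * r + 3 * Num.sqrt (q * l).
  rewrite ler_norml lerNl; apply/andP; split; rewrite leNgt; apply/negP => h.
    by apply: n2; exists X => //; rewrite mulN1r.
  by apply: n1; exists X => //; rewrite mul1r.
(* Subadditivity of the square root, checked on squares. *)
have r_le : r <= Num.sqrt n%:R + Num.sqrt m%:R + Num.sqrt (Num.sqrt (s_ones w)%:R).
  rewrite -[r]addr0 lerD ?sqrtr_ge0 // -ler_sqr ?nnegrE ?addr_ge0 ?sqrtr_ge0 //.
  rewrite sqr_sqrtr // sqrrD !sqr_sqrtr // natrD.
  have : 0 <= Num.sqrt n%:R * Num.sqrt m%:R :> R by rewrite mulr_ge0 ?sqrtr_ge0.
  by rewrite mulr2n; lra.
set u := _ + _ + _ in r_le *; have sq0 : 0 < Num.sqrt q by rewrite sqrtr_gt0.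
have -> : t * 78 * u / ((1 - rho) * q) + 3 * Num.sqrt l / (Num.sqrt q * (1 - rho))
    = q^-1 / (1 - rho) * (78 * t * u + 3 * Num.sqrt (q * l)).
  rewrite sqrtrM ?ltW // -{1 3}(sqr_sqrtr (ltW mn0)).
  by field; rewrite !lt0r_neq0.
rewrite ler_wpM2l //; apply: le_trans s_le _.
by rewrite lerD2r ler_wpM2l // mulr_ge0 // ltW.
Qed.
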